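(* Let $n\in\{0,1,2,\dots\}$. a. Assume that $S(\delta)$ is a smooth real-valued function of $\delta\in(0,n+1]$ with $S(n+1)=0$ and $S(\delta)>0$ for $\delta\in(0,n+1)$, and that $$S(\delta)>-\delta\,S'(\delta)\bigl(S(\delta)-(n+1-\delta)\bigr),\qquad \delta\in(0,n+1).$$ Then $S(\delta)<s_n(\delta)$ for all $\delta\in(0,n+1)$. b. Assume that $S(\delta)$ is a smooth real-valued function of $\delta\in(0,n+1]$ with $S(n+1)\ge 0$ and $S(\delta)>0$ for $\delta\in(0,n+1)$, and that $$S(\delta)<-\delta\,S'(\delta)\bigl(S(\delta)-(n+1-\delta)\bigr),\qquad \delta\in(0,n+1).$$ Then $S(\delta)>s_n(\delta)$ for all $\delta\in(0,n+1)$.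
   Context: For $n\in\{0,1,2,\dots\}$ and $\delta\in(0,n+1)$, $s_n(\delta)$ denotes the unique positive solution $s$ of $$e^s=1+\frac{s^1}{1!}+\dots+\frac{s^n}{n!}+\frac{1}{\delta}\,\frac{s^{n+1}}{n!}.$$ ''Smooth on $(0,n+1]$'' means continuously differentiable on $(0,n+1]$ (one-sided at the endpoint $n+1$). *)

(* Defs.v *)
From Stdlib Require Import Reals Factorial Lra Lia ClassicalEpsilon.
Open Scope R_scope.

Definition sn_equation (n : nat) (delta s : R) : Prop :=
  exp s = sum_f_R0 (fun k => s ^ k / INR (fact k)) n
          + / delta * (s ^ (n + 1) / INR (fact n)).

(* Meaningful only for 0 < delta < n + 1: see [sn_unique_solution] below. *)
Definition sn (n : nat) (delta : R) : R :=
  epsilon (inhabits 0) (fun s => 0 < s /\ sn_equation n delta s).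

(* f is C^1 on D with derivative f'. Difference quotients and limits are taken
   within D, hence are one-sided at an endpoint belonging to D; the values of
   f and f' outside D are irrelevant. *)
Definition C1_on (D : R -> Prop) (f f' : R -> R) : Prop :=
  forall x, D x -> D_in f f' D x /\ continue_in f' D x.

(* The Taylor remainder of exp: exp s minus the terms of degree < m. *)
Fixpoint exp_rem (m : nat) (s : R) : R :=
  match m with
  | O => exp s
  | S p => exp_rem p s - s ^ p / INR (fact p)
  end.

Lemma exp_rem_sum n s :
  exp_rem (S n) s = exp s - sum_f_R0 (fun k => s ^ k / INR (fact k)) n.
Proof.
  induction n as [|n IH]; [reflexivity|].
  change (exp_rem (S (S n)) s)
    with (exp_rem (S n) s - s ^ S n / INR (fact (S n))).
  rewrite IH, tech5; lra.
Qed.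

Lemma INR_fact_pos m : 0 < INR (fact m).
Proof. apply INR_fact_lt_0. Qed.

Lemma INR_fact_S m : INR (fact (S m)) = (INR m + 1) * INR (fact m).
Proof. rewrite fact_simpl, mult_INR, S_INR; reflexivity. Qed.

Lemma derivable_pt_lim_monomial p s :
  derivable_pt_lim (fun x => x ^ S p / INR (fact (S p))) s
    (s ^ p / INR (fact p)).
Proof.
  replace (s ^ p / INR (fact p))
    with (INR (S p) * s ^ p * / INR (fact (S p)) + s ^ S p * 0).
  - apply (derivable_pt_lim_mult (fun x => x ^ S p)
             (fun _ => / INR (fact (S p)))).
    + exact (derivable_pt_lim_pow s (S p)).
    + apply derivable_pt_lim_const.
  - rewrite INR_fact_S, S_INR.
    pose proof (INR_fact_pos p); pose proof (pos_INR p).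
    field; lra.
Qed.

Lemma derivable_pt_lim_exp_rem p s :
  derivable_pt_lim (exp_rem (S p)) s (exp_rem p s).
Proof.
  induction p as [|p IH].
  - replace (exp_rem 0 s) with (exp s - 0) by (simpl; lra).
    apply (derivable_pt_lim_minus exp (fun x => x ^ 0 / INR (fact 0))).
    + apply derivable_pt_lim_exp.
    + exact (derivable_pt_lim_const (1 / INR (fact 0)) s).
  - apply (derivable_pt_lim_minus (exp_rem (S p))).
    + exact IH.
    + apply derivable_pt_lim_monomial.
Qed.

Lemma exp_rem_0 p : exp_rem (S p) 0 = 0.
Proof.
  induction p as [|p IH].
  - simpl; rewrite exp_0; lra.
  - change (exp_rem (S p) 0 - 0 ^ S p / INR (fact (S p)) = 0).
    rewrite IH, pow_i by lia; lra.
Qed.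

Lemma pos_of_deriv_pos f f' :
  f 0 = 0 -> (forall x, 0 <= x -> derivable_pt_lim f x (f' x)) ->
  (forall x, 0 < x -> 0 < f' x) -> forall x, 0 < x -> 0 < f x.
Proof.
  intros f0 df f'pos x xpos.
  destruct (MVT_cor2 f f' 0 x xpos) as [c [e [c0 _]]].
  - intros c [c0 _]; exact (df c c0).
  - rewrite f0 in e; pose proof (f'pos c c0); nra.
Qed.

Lemma exp_rem_pos m : forall s, 0 < s -> 0 < exp_rem m s.
Proof.
  induction m as [|p IH].
  - intros s _; apply exp_pos.
  - apply (pos_of_deriv_pos _ (exp_rem p)); [apply exp_rem_0| |exact IH].
    intros x _; apply derivable_pt_lim_exp_rem.
Qed.

Lemma exp_rem_lt p : forall s, 0 < s ->
  0 < s ^ S p / INR (fact (S p)) * exp s - exp_rem (S p) s.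
Proof.
  assert (step : forall q x, derivable_pt_lim
    (fun x => x ^ S q / INR (fact (S q)) * exp x - exp_rem (S q) x) x
    (x ^ q / INR (fact q) * exp x + x ^ S q / INR (fact (S q)) * exp x
     - exp_rem q x)).
  { intros q x.
    apply (derivable_pt_lim_minus
             (fun x => x ^ S q / INR (fact (S q)) * exp x) (exp_rem (S q))).
    - apply (derivable_pt_lim_mult (fun x => x ^ S q / INR (fact (S q))) exp).
      + apply derivable_pt_lim_monomial.
      + apply derivable_pt_lim_exp.
    - apply derivable_pt_lim_exp_rem. }
  assert (tpos : forall q x, 0 < x -> 0 < x ^ q / INR (fact q) * exp x).
  { intros q x xpos; apply Rmult_lt_0_compat; [|apply exp_pos].
    apply Rdiv_lt_0_compat; [now apply pow_lt|apply INR_fact_pos]. }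
  induction p as [|p IH].
  - eapply pos_of_deriv_pos; [|intros x _; apply step|].
    + rewrite exp_rem_0, pow_i by lia; lra.
    + intros x xpos; cbv beta; pose proof (tpos 1%nat x xpos).
      replace (x ^ 0 / INR (fact 0)) with 1 by (simpl; field).
      change (exp_rem 0 x) with (exp x); lra.
  - eapply pos_of_deriv_pos; [|intros x _; apply step|].
    + rewrite exp_rem_0, pow_i by lia; lra.
    + intros x xpos; cbv beta; pose proof (tpos (S (S p)) x xpos).
      pose proof (IH x xpos); lra.
Qed.

Lemma exp_rem_ratio_deriv_pos m : forall s, 0 < s ->
  0 < s * exp_rem m s - (INR m + 1) * exp_rem (S m) s.
Proof.
  induction m as [|m IH].
  - apply (pos_of_deriv_pos _ (fun x => x * exp x)).
    + rewrite exp_rem_0; lra.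
    + intros x _.
      replace (x * exp x)
        with ((1 * exp x + x * exp x)
              - (0 * exp_rem 1 x + (INR 0 + 1) * exp x)) by (simpl; lra).
      apply (derivable_pt_lim_minus (fun s => s * exp s)
               (fun s => (INR 0 + 1) * exp_rem 1 s)).
      * apply (derivable_pt_lim_mult id exp);
          [apply derivable_pt_lim_id|apply derivable_pt_lim_exp].
      * apply (derivable_pt_lim_mult (fun _ => INR 0 + 1) (exp_rem 1));
          [apply derivable_pt_lim_const|apply derivable_pt_lim_exp_rem].
    + intros x xpos; pose proof (exp_pos x); nra.
  - eapply pos_of_deriv_pos; [| |exact IH].
    + rewrite !exp_rem_0; lra.
    + intros x _; cbv beta.
      replace (x * exp_rem m x - (INR m + 1) * exp_rem (S m) x)
        with ((1 * exp_rem (S m) x + x * exp_rem m x)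
              - (0 * exp_rem (S (S m)) x + (INR (S m) + 1) * exp_rem (S m) x))
        by (rewrite S_INR; lra).
      apply (derivable_pt_lim_minus (fun s => s * exp_rem (S m) s)
               (fun s => (INR (S m) + 1) * exp_rem (S (S m)) s)).
      * apply (derivable_pt_lim_mult id (exp_rem (S m)));
          [apply derivable_pt_lim_id|apply derivable_pt_lim_exp_rem].
      * apply (derivable_pt_lim_mult (fun _ => INR (S m) + 1)
                 (exp_rem (S (S m))));
          [apply derivable_pt_lim_const|apply derivable_pt_lim_exp_rem].
Qed.

Lemma exp_rem_ratio_increasing m a b : 0 < a -> a < b ->
  exp_rem (S m) a / a ^ S m < exp_rem (S m) b / b ^ S m.
Proof.
  intros apos ab.
  destruct (MVT_cor2 (fun x => exp_rem (S m) x / x ^ S m)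
    (fun x => (exp_rem m x * x ^ S m
               - INR (S m) * x ^ m * exp_rem (S m) x) / Rsqr (x ^ S m))
    a b ab) as [c [e [ac _]]].
  - intros c [ac _].
    apply (derivable_pt_lim_div (exp_rem (S m)) (fun x => x ^ S m)).
    + apply derivable_pt_lim_exp_rem.
    + exact (derivable_pt_lim_pow c (S m)).
    + apply pow_nonzero; lra.
  - assert (cpos : 0 < c) by lra.
    match type of e with _ = ?q * _ => assert (0 < q) end; [|nra].
    apply Rdiv_lt_0_compat.
    + replace (exp_rem m c * c ^ S m - INR (S m) * c ^ m * exp_rem (S m) c)
        with (c ^ m * (c * exp_rem m c - (INR m + 1) * exp_rem (S m) c))
        by (rewrite S_INR; simpl pow; ring).
      apply Rmult_lt_0_compat;
        [now apply pow_lt|now apply exp_rem_ratio_deriv_pos].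
    + apply Rlt_0_sqr, pow_nonzero; lra.
Qed.

Lemma sn_equation_rem n delta s :
  sn_equation n delta s <->
  exp_rem (S n) s = / delta * (s ^ S n / INR (fact n)).
Proof.
  unfold sn_equation; rewrite exp_rem_sum, Nat.add_1_r; split; lra.
Qed.

Lemma sn_equation_exists n delta : 0 < delta < INR n + 1 ->
  exists s, 0 < s /\ sn_equation n delta s.
Proof.
  intros [dpos dlt].
  pose proof (INR_fact_pos n) as fpos; pose proof (pos_INR n) as npos.
  set (g := fun s => exp_rem (S n) s - / delta * (s ^ S n / INR (fact n))).
  set (b := (INR n + 2) * (INR n + 1) / delta).
  set (l := ln ((INR n + 1) / delta)).
  set (a := Rmin l b / 2).
  assert (bpos : 0 < b) by (apply Rdiv_lt_0_compat; nra).
  assert (lpos : 0 < l).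
  { unfold l; rewrite <- ln_1; apply ln_increasing; [lra|].
    apply (Rmult_lt_reg_r delta); [lra|].
    unfold Rdiv; rewrite Rmult_assoc, Rinv_l; lra. }
  assert (apos : 0 < a).
  { unfold a; pose proof (Rmin_glb_lt l b 0 lpos bpos); lra. }
  assert (al : a < l) by (unfold a in *; pose proof (Rmin_l l b); lra).
  assert (ab : a < b) by (unfold a in *; pose proof (Rmin_r l b); lra).
  assert (gc : continuity g).
  { intro x; unfold g.
    apply (continuity_pt_minus (exp_rem (S n))
             (fun s => / delta * (s ^ S n / INR (fact n)))).
    - apply derivable_continuous_pt; exists (exp_rem n x).
      apply derivable_pt_lim_exp_rem.
    - reg. }
  assert (ga : g a < 0).
  { unfold g; pose proof (exp_rem_lt n a apos) as H.
    assert (ea : exp a < (INR n + 1) / delta).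
    { rewrite <- (exp_ln ((INR n + 1) / delta));
        [now apply exp_increasing|apply Rdiv_lt_0_compat; lra]. }
    assert (P : 0 < a ^ S n / INR (fact (S n)))
      by (apply Rdiv_lt_0_compat; [now apply pow_lt|apply INR_fact_pos]).
    replace (/ delta * (a ^ S n / INR (fact n)))
      with (a ^ S n / INR (fact (S n)) * ((INR n + 1) / delta))
      by (rewrite INR_fact_S; field; lra).
    nra. }
  assert (gb : 0 < g b).
  { unfold g; pose proof (exp_rem_pos (S (S (S n))) b bpos) as H.
    change (0 < exp_rem (S n) b - b ^ S n / INR (fact (S n))
                - b ^ S (S n) / INR (fact (S (S n)))) in H.
    assert (P : 0 < b ^ S n / INR (fact (S n)))
      by (apply Rdiv_lt_0_compat; [now apply pow_lt|apply INR_fact_pos]).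
    replace (/ delta * (b ^ S n / INR (fact n)))
      with (b ^ S (S n) / INR (fact (S (S n)))); [lra|].
    change (b ^ S (S n)) with (b * b ^ S n).
    rewrite !INR_fact_S, S_INR; unfold b at 1; field; lra. }
  destruct (IVT g a b gc ab ga gb) as [z [[az _] gz]].
  exists z; split; [lra|].
  apply sn_equation_rem; unfold g in gz; lra.
Qed.

Lemma sn_equation_unique n delta s t : 0 < s -> 0 < t ->
  sn_equation n delta s -> sn_equation n delta t -> s = t.
Proof.
  intros spos tpos; rewrite !sn_equation_rem; intros es et.
  assert (ratio : forall x, 0 < x ->
    exp_rem (S n) x = / delta * (x ^ S n / INR (fact n)) ->
    exp_rem (S n) x / x ^ S n = / delta * / INR (fact n)).
  { intros x xpos ->; unfold Rdiv.
    rewrite Rmult_assoc, (Rmult_comm (x ^ S n)), !Rmult_assoc, Rinv_r;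
      [ring|apply pow_nonzero; lra]. }
  pose proof (ratio s spos es); pose proof (ratio t tpos et).
  destruct (Rtotal_order s t) as [st|[st|st]]; [|exact st|].
  - pose proof (exp_rem_ratio_increasing n s t spos st); lra.
  - pose proof (exp_rem_ratio_increasing n t s tpos st); lra.
Qed.

Lemma sn_unique_solution n delta : 0 < delta < INR n + 1 ->
  unique (fun s => 0 < s /\ sn_equation n delta s) (sn n delta).
Proof.
  intros Hd.
  assert (spec : 0 < sn n delta /\ sn_equation n delta (sn n delta))
    by (apply (epsilon_spec (inhabits 0) _ (sn_equation_exists n delta Hd))).
  split; [exact spec|].
  intros t [tpos et]; destruct spec as [spos es].
  exact (sn_equation_unique n delta _ t spos tpos es et).
Qed.

(* Main.v *)
Require Import Defs.
From Stdlib Require Import Reals Factorial Lra.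
Open Scope R_scope.

(** Write [N] for [n + 1].  Solving the equation of [sn] for [delta] gives the
    explicit function [delta = sn_inv n s], which is positive and decreasing on
    [s > 0], tends to [N] at [0] and satisfies, as [exp_rem n] is the derivative
    of [exp_rem (n + 1)], the differential equation
    [s * D' = D * (N - s - D)].  Hence [S < sn] if and only if
    [K delta = sn_inv n (S delta) - delta] is positive, and
    [K' = D * X - 1] with [D = sn_inv n S] and [X = S' / S * (N - S - D)].
    The differential inequality on [S] compares [X] with [1 / delta] once [D]
    is replaced by [delta]; so it fixes the sign of [K'] wherever [K = 0]: [K]
    can only cross zero downwards in part a, upwards in part b.

    If the conclusion failed somewhere, [K] would therefore keep the wrong sign
    up to [N] ([barrier]).  The sign of [S'] near [N] then shows that [K] even
    moves away from zero there.  But [N - s < D < N] squeezes [K] to zero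
    at [N], a contradiction ([sn_inv_lower], [sn_inv_upper]).  The sign of
    [S'] is negative in both parts: in part a because [K < 0] forces
    [S > N - delta], so [S' N <= -1]; in part b because the inequality keeps
    [S - (N - delta)] away from zero, and if it were negative then [S] would be
    increasing and yet squeezed to zero at [N]. *)

(** * Sign of a function of one variable *)

Lemma derivable_pt_lim_continuous f l x :
  derivable_pt_lim f x l -> continuity_pt f x.
Proof.
  intros H; apply derivable_continuous_pt; exists l; exact H.
Qed.

Lemma continuity_pt_near f c e : continuity_pt f c -> 0 < e ->
  exists eta, 0 < eta /\
    forall y, Rabs (y - c) < eta -> Rabs (f y - f c) < e.
Proof.
  intros H e0; destruct (H e e0) as [eta [eta0 He]].
  exists eta; split; [exact eta0|intros y yc].
  destruct (Req_dec y c) as [->|ne].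
  - rewrite Rminus_diag, Rabs_R0; exact e0.
  - apply He; split; [|exact yc].
    split; [exact I|congruence].
Qed.

Lemma derivable_pt_lim_neg_local f c l : derivable_pt_lim f c l -> l < 0 ->
  exists eta, 0 < eta /\
    (forall y, c - eta < y < c -> f c < f y) /\
    (forall y, c < y < c + eta -> f y < f c).
Proof.
  intros H l0.
  assert (e0 : 0 < - l) by lra.
  destruct (H (- l) e0) as [eta He].
  assert (key : forall y, y <> c -> Rabs (y - c) < eta ->
    (f y - f c) / (y - c) < 0).
  { intros y ne yc.
    assert (h0 : y - c <> 0) by lra.
    specialize (He (y - c) h0 yc).
    replace (c + (y - c)) with y in He by ring.
    apply Rabs_def2 in He; lra. }
  assert (split_quot : forall y, y <> c ->
    f y - f c = (f y - f c) / (y - c) * (y - c)) by (intros; field; lra).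
  exists eta; split; [apply cond_pos|split; intros y Hy].
  - assert (q : (f y - f c) / (y - c) < 0)
      by (apply key; [lra|apply Rabs_def1; lra]).
    pose proof (split_quot y ltac:(lra)); nra.
  - assert (q : (f y - f c) / (y - c) < 0)
      by (apply key; [lra|apply Rabs_def1; lra]).
    pose proof (split_quot y ltac:(lra)); nra.
Qed.

(** If [f] were nonnegative at some [x], it would be positive at some [x'] at
    or before [x]; at the last point [c < x'] with [f c <= 0] the function
    would then be about to become positive, although [f c < 0] or [f' c < 0]. *)
Lemma barrier f f' a b :
  (forall y, a <= y < b -> derivable_pt_lim f y (f' y)) ->
  (forall y, a <= y < b -> f y = 0 -> f' y < 0) ->
  f a <= 0 -> forall x, a < x < b -> f x < 0.
Proof.
  intros df f0 fa x Hx.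
  destruct (Rlt_or_le (f x) 0) as [|fx]; [assumption|exfalso].
  assert (exists x', a < x' <= x /\ 0 < f x') as [x' [Hx' fx']].
  { destruct fx as [fx|fx]; [exists x; lra|].
    destruct (derivable_pt_lim_neg_local f x (f' x)) as [eta [eta0 [left _]]].
    - apply df; lra.
    - apply f0; lra.
    - pose proof (Rmax_l a (x - eta)); pose proof (Rmax_r a (x - eta)).
      pose proof (Rmax_lub_lt a (x - eta) x ltac:(lra) ltac:(lra)).
      exists ((Rmax a (x - eta) + x) / 2); split; [lra|].
      rewrite fx; apply left; lra. }
  destruct (completeness (fun y => a <= y <= x' /\ f y <= 0)) as [c [ub lub]].
  - exists x'; intros y [Hy _]; lra.
  - exists a; lra.
  - assert (ac : a <= c) by (apply ub; lra).
    assert (cx : c <= x') by (apply lub; intros y [Hy _]; lra).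
    assert (dc : derivable_pt_lim f c (f' c)) by (apply df; lra).
    pose proof (derivable_pt_lim_continuous _ _ _ dc) as cc.
    assert (fc : f c <= 0).
    { destruct (Rle_or_lt (f c) 0) as [|fc]; [assumption|exfalso].
      destruct (continuity_pt_near f c (f c) cc fc) as [eta [eta0 near]].
      enough (c <= c - eta) by lra.
      apply lub; intros y Hy.
      destruct (Rle_or_lt y (c - eta)) as [|yc]; [assumption|exfalso].
      pose proof (ub y Hy).
      assert (d : Rabs (f y - f c) < f c)
        by (apply near, Rabs_def1; lra).
      apply Rabs_def2 in d; lra. }
    assert (c <> x') by (intros ->; lra).
    assert (exists eta, 0 < eta /\ forall y, c < y < c + eta -> f y < 0)
      as [eta [eta0 right]].
    { destruct fc as [fc|fc].
      - destruct (continuity_pt_near f c (- f c) cc) as [eta [eta0 near]];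
          [lra|].
        exists eta; split; [exact eta0|intros y Hy].
        assert (d : Rabs (f y - f c) < - f c)
          by (apply near, Rabs_def1; lra).
        apply Rabs_def2 in d; lra.
      - destruct (derivable_pt_lim_neg_local f c (f' c) dc)
          as [eta [eta0 [_ right]]]; [apply f0; lra|].
        exists eta; split; [exact eta0|intros y Hy].
        rewrite <- fc; apply right; exact Hy. }
    pose proof (Rmin_l x' (c + eta)); pose proof (Rmin_r x' (c + eta)).
    pose proof (Rmin_glb_lt x' (c + eta) c ltac:(lra) ltac:(lra)).
    set (y := (c + Rmin x' (c + eta)) / 2).
    assert (Hy : c < y < c + eta /\ y < x') by (unfold y; lra).
    pose proof (right y ltac:(lra)).
    enough (y <= c) by lra.
    apply ub; lra.
Qed.

Lemma deriv_pos_increasing f f' a b :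
  (forall y, a <= y < b -> derivable_pt_lim f y (f' y)) ->
  (forall y, a < y < b -> 0 < f' y) ->
  forall y, a < y < b -> f a < f y.
Proof.
  intros df f0 y Hy.
  destruct (MVT_cor2 f f' a y) as [c [e Hc]]; [lra| |].
  - intros c Hc; apply df; lra.
  - pose proof (f0 c ltac:(lra)); nra.
Qed.

Lemma deriv_neg_decreasing f f' a b :
  (forall y, a <= y < b -> derivable_pt_lim f y (f' y)) ->
  (forall y, a < y < b -> f' y < 0) ->
  forall y, a < y < b -> f y < f a.
Proof.
  intros df f0 y Hy.
  destruct (MVT_cor2 f f' a y) as [c [e Hc]]; [lra| |].
  - intros c Hc; apply df; lra.
  - pose proof (f0 c ltac:(lra)); nra.
Qed.

(** * Derivatives within an interval *)

Lemma C1_on_derivable_pt_lim f f' b x :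
  C1_on (fun y => 0 < y <= b) f f' -> 0 < x < b ->
  derivable_pt_lim f x (f' x).
Proof.
  intros H Hx e e0.
  destruct (proj1 (H x ltac:(lra)) e e0) as [eta [eta0 He]].
  pose proof (Rmin_l eta (Rmin x (b - x))).
  pose proof (Rmin_r eta (Rmin x (b - x))).
  pose proof (Rmin_l x (b - x)); pose proof (Rmin_r x (b - x)).
  assert (d0 : 0 < Rmin eta (Rmin x (b - x)))
    by (repeat apply Rmin_glb_lt; lra).
  exists (mkposreal _ d0); simpl; intros h h0 hd.
  pose proof (Rabs_def2 _ _ hd).
  specialize (He (x + h)); simpl in He; unfold Rdist, D_x in He.
  replace (x + h - x) with h in He by ring.
  apply He; repeat split; lra.
Qed.

Lemma limit1_in_left f b l e :
  limit1_in f (D_x (fun y => 0 < y <= b) b) l b -> 0 < b -> 0 < e ->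
  exists d, 0 <= d < b /\ forall y, d < y < b -> Rabs (f y - l) < e.
Proof.
  intros H b0 e0; destruct (H e e0) as [eta [eta0 He]].
  exists (Rmax 0 (b - eta)).
  pose proof (Rmax_l 0 (b - eta)); pose proof (Rmax_r 0 (b - eta)).
  split; [split; [lra|apply Rmax_lub_lt; lra]|].
  intros y Hy; apply (He y).
  simpl; unfold Rdist, D_x; repeat split; try lra.
  apply Rabs_def1; lra.
Qed.

(** * The inverse function of [sn] *)

Definition sn_inv (n : nat) (s : R) : R :=
  s ^ S n / INR (fact n) / exp_rem (S n) s.

Lemma sn_inv_pos n s : 0 < s -> 0 < sn_inv n s.
Proof.
  intros s0; unfold sn_inv.
  apply Rdiv_lt_0_compat; [|now apply exp_rem_pos].
  apply Rdiv_lt_0_compat; [now apply pow_lt|apply INR_fact_pos].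
Qed.

(** The remainder [exp_rem (n + 1) s] exceeds its leading term
    [s ^ (n + 1) / (n + 1)!]. *)
Lemma sn_inv_upper n s : 0 < s -> sn_inv n s < INR n + 1.
Proof.
  intros s0.
  pose proof (exp_rem_pos (S n) s s0) as E0.
  pose proof (exp_rem_pos (S (S n)) s s0) as E1.
  change (0 < exp_rem (S n) s - s ^ S n / INR (fact (S n))) in E1.
  pose proof (INR_fact_pos n); pose proof (pos_INR n).
  rewrite INR_fact_S in E1.
  apply (Rmult_lt_reg_r (exp_rem (S n) s)); [exact E0|].
  replace (sn_inv n s * exp_rem (S n) s)
    with ((INR n + 1) * (s ^ S n / ((INR n + 1) * INR (fact n))))
    by (unfold sn_inv; field; lra).
  apply Rmult_lt_compat_l; lra.
Qed.

Lemma exp_rem_S_sn_inv n s : 0 < s ->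
  s * exp_rem n s = exp_rem (S n) s * (s + sn_inv n s).
Proof.
  intros s0.
  pose proof (exp_rem_pos (S n) s s0) as E0; pose proof (INR_fact_pos n).
  replace (exp_rem n s) with (exp_rem (S n) s + s ^ n / INR (fact n))
    by (simpl; ring).
  unfold sn_inv; change (s ^ S n) with (s * s ^ n); field; lra.
Qed.

(** This is the monotonicity of [exp_rem (n + 1) s / s ^ (n + 1)] in disguise:
    the sign of its derivative is that of [s + sn_inv n s - (n + 1)]. *)
Lemma sn_inv_lower n s : 0 < s -> INR n + 1 - s < sn_inv n s.
Proof.
  intros s0.
  pose proof (exp_rem_pos (S n) s s0) as E0.
  pose proof (exp_rem_ratio_deriv_pos n s s0) as H.
  rewrite exp_rem_S_sn_inv in H by exact s0; nra.
Qed.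

Lemma derivable_pt_lim_sn_inv n s : 0 < s ->
  derivable_pt_lim (sn_inv n) s
    (sn_inv n s * ((INR n + 1 - s - sn_inv n s) / s)).
Proof.
  intros s0.
  pose proof (exp_rem_pos (S n) s s0) as E0; pose proof (INR_fact_pos n).
  replace (sn_inv n s * ((INR n + 1 - s - sn_inv n s) / s))
    with (((INR (S n) * s ^ n * / INR (fact n) + s ^ S n * 0)
             * exp_rem (S n) s
           - exp_rem n s * (s ^ S n / INR (fact n))) / Rsqr (exp_rem (S n) s)).
  - apply (derivable_pt_lim_div (fun s => s ^ S n / INR (fact n))
             (exp_rem (S n))).
    + apply (derivable_pt_lim_mult (fun s => s ^ S n)
               (fun _ => / INR (fact n))).
      * exact (derivable_pt_lim_pow s (S n)).
      * apply derivable_pt_lim_const.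
    + apply derivable_pt_lim_exp_rem.
    + lra.
  - assert (e : exp_rem n s = exp_rem (S n) s * (s + sn_inv n s) / s)
      by (rewrite <- exp_rem_S_sn_inv by exact s0; field; lra).
    rewrite e; unfold sn_inv, Rsqr; rewrite S_INR.
    change (s ^ S n) with (s * s ^ n); field; lra.
Qed.

Lemma sn_inv_decreasing n a b : 0 < a -> a < b -> sn_inv n b < sn_inv n a.
Proof.
  intros a0 ab.
  apply (deriv_neg_decreasing (sn_inv n)
           (fun s => sn_inv n s * ((INR n + 1 - s - sn_inv n s) / s))
           a (b + 1)); [| |lra].
  - intros y Hy; apply derivable_pt_lim_sn_inv; lra.
  - intros y Hy.
    pose proof (sn_inv_pos n y ltac:(lra)).
    pose proof (sn_inv_lower n y ltac:(lra)).
    assert (0 < (y + sn_inv n y - (INR n + 1)) / y)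
      by (apply Rdiv_lt_0_compat; lra).
    replace ((INR n + 1 - y - sn_inv n y) / y)
      with (- ((y + sn_inv n y - (INR n + 1)) / y)) by (field; lra).
    nra.
Qed.

Lemma sn_inv_sn n delta : 0 < delta < INR n + 1 ->
  0 < sn n delta /\ sn_inv n (sn n delta) = delta.
Proof.
  intros Hd; destruct (sn_unique_solution n delta Hd) as [[s0 e] _].
  split; [exact s0|].
  apply sn_equation_rem in e; unfold sn_inv; rewrite e.
  pose proof (INR_fact_pos n); pose proof (pow_lt _ (S n) s0).
  field; repeat split; lra.
Qed.

Lemma lt_sn n delta s : 0 < delta < INR n + 1 -> 0 < s ->
  delta < sn_inv n s -> s < sn n delta.
Proof.
  intros Hd s0 H; destruct (sn_inv_sn n delta Hd) as [t0 e].
  destruct (Rtotal_order s (sn n delta)) as [|[->|lt]]; [assumption|lra|].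
  pose proof (sn_inv_decreasing n _ _ t0 lt); lra.
Qed.

Lemma gt_sn n delta s : 0 < delta < INR n + 1 -> 0 < s ->
  sn_inv n s < delta -> sn n delta < s.
Proof.
  intros Hd s0 H; destruct (sn_inv_sn n delta Hd) as [t0 e].
  destruct (Rtotal_order s (sn n delta)) as [lt|[->|]]; [|lra|assumption].
  pose proof (sn_inv_decreasing n _ _ s0 lt); lra.
Qed.

(** * The gap along a comparison function *)

Definition gap (n : nat) (f : R -> R) (d : R) : R := sn_inv n (f d) - d.

Definition gap_deriv (n : nat) (f f' : R -> R) (d : R) : R :=
  sn_inv n (f d) * ((INR n + 1 - f d - sn_inv n (f d)) / f d) * f' d - 1.

Lemma derivable_pt_lim_gap n f f' d : 0 < f d ->
  derivable_pt_lim f d (f' d) ->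
  derivable_pt_lim (gap n f) d (gap_deriv n f f' d).
Proof.
  intros f0 df; unfold gap, gap_deriv.
  apply (derivable_pt_lim_minus (fun d => sn_inv n (f d)) id).
  - exact (derivable_pt_lim_comp f (sn_inv n) d _ _ df
             (derivable_pt_lim_sn_inv n (f d) f0)).
  - apply derivable_pt_lim_id.
Qed.

(** In terms of [X = f' / f * (n + 1 - f - D)], where [D = sn_inv n f], the
    differential inequality says [X - f' / f * (d - D) < 1 / d]; the hypothesis
    [f' * (d - D) <= 0] thus gives [X < 1 / d], and [D <= d] gives
    [D * X < 1]. *)
Lemma gap_deriv_neg n f f' d : 0 < d -> 0 < f d ->
  f d > - d * f' d * (f d - (INR n + 1 - d)) ->
  gap n f d <= 0 -> f' d * gap n f d >= 0 -> gap_deriv n f f' d < 0.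
Proof.
  unfold gap, gap_deriv; intros d0 f0 H K0 KS.
  pose proof (sn_inv_pos n (f d) f0) as D0.
  set (D := sn_inv n (f d)) in *.
  set (Y := f' d * (INR n + 1 - f d - D)).
  assert (HY : d * Y < f d) by (unfold Y; nra).
  replace (D * ((INR n + 1 - f d - D) / f d) * f' d) with (D * Y / f d)
    by (unfold Y; field; lra).
  enough (D * Y / f d < 1) by lra.
  apply (Rmult_lt_reg_r (f d)); [exact f0|].
  replace (D * Y / f d * f d) with (D * Y) by (field; lra).
  destruct (Rle_or_lt Y 0); nra.
Qed.

(** The mirror image of [gap_deriv_neg]: here [X > 1 / d] and [D >= d]. *)
Lemma gap_deriv_pos n f f' d : 0 < d -> 0 < f d ->
  f d < - d * f' d * (f d - (INR n + 1 - d)) ->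
  gap n f d >= 0 -> f' d * gap n f d <= 0 -> 0 < gap_deriv n f f' d.
Proof.
  unfold gap, gap_deriv; intros d0 f0 H K0 KS.
  set (D := sn_inv n (f d)) in *.
  set (Y := f' d * (INR n + 1 - f d - D)).
  assert (HY : f d < d * Y) by (unfold Y; nra).
  replace (D * ((INR n + 1 - f d - D) / f d) * f' d) with (D * Y / f d)
    by (unfold Y; field; lra).
  enough (1 < D * Y / f d) by lra.
  apply (Rmult_lt_reg_r (f d)); [exact f0|].
  replace (D * Y / f d * f d) with (D * Y) by (field; lra).
  assert (0 < Y) by nra; nra.
Qed.

(** * Comparison with [sn] *)

(** If [gap] is nonpositive at [d], it is negative on all of [(d, n + 1)].
    Where it is negative, [f] exceeds [n + 1 - y], so that [f' <= -1] at the
    endpoint and [gap] decreases on some final interval.  But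
    [gap y > n + 1 - f y - y], and the right-hand side tends to zero. *)
Lemma subsolution_lt_sn n f f' :
  C1_on (fun d => 0 < d <= INR n + 1) f f' ->
  f (INR n + 1) = 0 ->
  (forall d, 0 < d < INR n + 1 -> 0 < f d) ->
  (forall d, 0 < d < INR n + 1 ->
     f d > - d * f' d * (f d - (INR n + 1 - d))) ->
  forall d, 0 < d < INR n + 1 -> f d < sn n d.
Proof.
  intros C fN f0 H d Hd; set (N := INR n + 1) in *.
  assert (df : forall y, 0 < y < N -> derivable_pt_lim f y (f' y))
    by (intros y Hy; exact (C1_on_derivable_pt_lim f f' N y C Hy)).
  assert (dK : forall y, 0 < y < N ->
    derivable_pt_lim (gap n f) y (gap_deriv n f f' y))
    by (intros y Hy; apply derivable_pt_lim_gap; auto).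
  apply lt_sn; [exact Hd|auto|].
  destruct (Rlt_or_le 0 (gap n f d)) as [|Kd]; [unfold gap in *; lra|exfalso].
  assert (Kneg : forall y, d < y < N -> gap n f y < 0).
  { apply (barrier (gap n f) (gap_deriv n f f')); [| |exact Kd].
    - intros y Hy; apply dK; lra.
    - intros y Hy Ky; apply gap_deriv_neg.
      + lra.
      + apply f0; lra.
      + apply H; lra.
      + lra.
      + rewrite Ky; lra. }
  assert (above : forall y, d < y < N -> N - y < f y).
  { intros y Hy; pose proof (Kneg y Hy) as Ky.
    pose proof (sn_inv_lower n (f y) (f0 y ltac:(lra))) as L.
    unfold gap in Ky; fold N in L; lra. }
  destruct (C N ltac:(lra)) as [DN cN].
  (* Since [f N = 0], the bound [f y > N - y] puts every difference quotient at
     [N] below -1. *)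
  assert (f'N : f' N <= -1).
  { destruct (Rle_or_lt (f' N) (-1)) as [|lt]; [assumption|exfalso].
    destruct (limit1_in_left _ N _ (f' N + 1) DN) as [c [Hc near]];
      [lra|lra|].
    pose proof (Rmax_l c d); pose proof (Rmax_r c d).
    pose proof (Rmax_lub_lt c d N ltac:(lra) ltac:(lra)).
    set (y := (Rmax c d + N) / 2).
    assert (Hy : c < y < N /\ d < y) by (unfold y; lra).
    specialize (near y ltac:(lra)); apply Rabs_def2 in near.
    pose proof (above y ltac:(lra)).
    rewrite fN in near.
    assert (e : f y - 0 = (f y - 0) / (y - N) * (y - N)) by (field; lra).
    nra. }
  destruct (limit1_in_left _ N _ 1 cN) as [c [Hc near]]; [lra|lra|].
  pose proof (Rmax_l c d); pose proof (Rmax_r c d).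
  pose proof (Rmax_lub_lt c d N ltac:(lra) ltac:(lra)).
  set (a := (Rmax c d + N) / 2).
  assert (Ha : c < a < N /\ d < a) by (unfold a; lra).
  pose proof (Kneg a ltac:(lra)) as Ka.
  assert (Kdec : forall y, a < y < N -> gap n f y < gap n f a).
  { apply (deriv_neg_decreasing (gap n f) (gap_deriv n f f')).
    - intros y Hy; apply dK; lra.
    - intros y Hy; pose proof (Kneg y ltac:(lra)).
      specialize (near y ltac:(lra)); apply Rabs_def2 in near.
      apply gap_deriv_neg; [lra|apply f0; lra|apply H; lra|lra|nra]. }
  destruct (limit1_in_left _ N _ (- gap n f a)
              (cont_deriv f f' _ N DN)) as [c' [Hc' small]]; [lra|lra|].
  pose proof (Rmax_l c' a); pose proof (Rmax_r c' a).
  pose proof (Rmax_lub_lt c' a N ltac:(lra) ltac:(lra)).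
  set (y := (Rmax c' a + N) / 2).
  assert (Hy : c' < y < N /\ a < y) by (unfold y; lra).
  specialize (small y ltac:(lra)); apply Rabs_def2 in small.
  pose proof (Kdec y ltac:(lra)) as Ky; unfold gap at 1 in Ky.
  pose proof (sn_inv_lower n (f y) (f0 y ltac:(lra))) as L; fold N in L.
  lra.
Qed.

(** The inequality forbids [f y = n + 1 - y], and [f] cannot lie below that line
    up to the endpoint; hence [f'] is negative throughout.  If [gap] is
    nonnegative at [d], it is therefore positive and increasing afterwards,
    against the bound [gap y < n + 1 - y]. *)
Lemma supersolution_gt_sn n f f' :
  C1_on (fun d => 0 < d <= INR n + 1) f f' ->
  (forall d, 0 < d < INR n + 1 -> 0 < f d) ->
  (forall d, 0 < d < INR n + 1 ->
     f d < - d * f' d * (f d - (INR n + 1 - d))) ->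
  forall d, 0 < d < INR n + 1 -> f d > sn n d.
Proof.
  intros C f0 H d Hd; set (N := INR n + 1) in *.
  assert (df : forall y, 0 < y < N -> derivable_pt_lim f y (f' y))
    by (intros y Hy; exact (C1_on_derivable_pt_lim f f' N y C Hy)).
  assert (dK : forall y, 0 < y < N ->
    derivable_pt_lim (gap n f) y (gap_deriv n f f' y))
    by (intros y Hy; apply derivable_pt_lim_gap; auto).
  assert (above : forall y, 0 < y < N -> N - y < f y).
  { intros z Hz; destruct (Rlt_or_le (N - z) (f z)) as [|le];
      [assumption|exfalso].
    (* [f y = N - y] is excluded by the inequality, so the condition of the
       barrier on the derivative at zeros is vacuous. *)
    assert (below : forall y, z < y < N -> f y - (N - y) < 0).
    { apply (barrier (fun y => f y - (N - y)) (fun y => f' y - (0 - 1)));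
        [| |lra].
      - intros y Hy.
        apply (derivable_pt_lim_minus f (fun y => N - y)); [apply df; lra|].
        apply (derivable_pt_lim_minus (fun _ => N) id);
          [apply derivable_pt_lim_const|apply derivable_pt_lim_id].
      - intros y Hy e; exfalso.
        pose proof (f0 y ltac:(lra)); pose proof (H y ltac:(lra)) as Hy'.
        rewrite e in Hy'; lra. }
    assert (inc : forall y, z < y < N -> f z < f y).
    { apply (deriv_pos_increasing f f'); [intros; apply df; lra|].
      intros y Hy; pose proof (below y Hy).
      pose proof (f0 y ltac:(lra)); pose proof (H y ltac:(lra)) as Hy'.
      destruct (Rlt_or_le 0 (f' y)) as [|s]; [assumption|exfalso].
      assert (y * f' y <= 0) by nra.
      nra. }
    pose proof (f0 z Hz).
    (* Past [N - f z], the line [N - y] is below [f z]. *)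
    pose proof (Rmax_l z (N - f z)); pose proof (Rmax_r z (N - f z)).
    pose proof (Rmax_lub_lt z (N - f z) N ltac:(lra) ltac:(lra)).
    set (y := (Rmax z (N - f z) + N) / 2).
    assert (Hy : z < y < N /\ N - f z < y) by (unfold y; lra).
    pose proof (below y ltac:(lra)); pose proof (inc y ltac:(lra)); lra. }
  assert (f'neg : forall y, 0 < y < N -> f' y < 0).
  { intros y Hy; pose proof (above y Hy).
    pose proof (f0 y Hy); pose proof (H y Hy) as Hy'.
    destruct (Rlt_or_le (f' y) 0) as [|s]; [assumption|exfalso].
    assert (0 <= y * f' y) by nra.
    nra. }
  apply gt_sn; [exact Hd|auto|].
  destruct (Rlt_or_le (gap n f d) 0) as [|Kd]; [unfold gap in *; lra|exfalso].
  assert (Kpos : forall y, d < y < N -> - gap n f y < 0).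
  { apply (barrier (fun y => - gap n f y) (fun y => - gap_deriv n f f' y));
      [| |lra].
    - intros y Hy; apply (derivable_pt_lim_opp (gap n f)), dK; lra.
    - intros y Hy Ky.
      enough (0 < gap_deriv n f f' y) by lra.
      apply gap_deriv_pos; [lra|apply f0; lra|apply H; lra|lra|].
      replace (gap n f y) with 0 by lra; lra. }
  set (a := (d + N) / 2).
  assert (Ha : d < a < N) by (unfold a; lra).
  pose proof (Kpos a Ha) as Ka.
  assert (Kinc : forall y, a < y < N -> gap n f a < gap n f y).
  { apply (deriv_pos_increasing (gap n f) (gap_deriv n f f')).
    - intros y Hy; apply dK; lra.
    - intros y Hy; pose proof (Kpos y ltac:(lra)).
      pose proof (f'neg y ltac:(lra)).
      apply gap_deriv_pos; [lra|apply f0; lra|apply H; lra|lra|nra]. }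
  pose proof (Rmax_l a (N - gap n f a)); pose proof (Rmax_r a (N - gap n f a)).
  pose proof (Rmax_lub_lt a (N - gap n f a) N ltac:(lra) ltac:(lra)).
  set (y := (Rmax a (N - gap n f a) + N) / 2).
  assert (Hy : a < y < N /\ N - gap n f a < y) by (unfold y; lra).
  pose proof (Kinc y ltac:(lra)) as Ky; unfold gap at 2 in Ky.
  pose proof (sn_inv_upper n (f y) (f0 y ltac:(lra))) as U; fold N in U.
  lra.
Qed.

Theorem proposition5 (n : nat) :
  (forall S S' : R -> R,
     C1_on (fun delta => 0 < delta <= INR n + 1) S S' ->
     S (INR n + 1) = 0 ->
     (forall delta, 0 < delta < INR n + 1 -> 0 < S delta) ->
     (forall delta, 0 < delta < INR n + 1 ->
        S delta > - delta * S' delta * (S delta - (INR n + 1 - delta))) ->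
     forall delta, 0 < delta < INR n + 1 -> S delta < sn n delta)
  /\
  (forall S S' : R -> R,
     C1_on (fun delta => 0 < delta <= INR n + 1) S S' ->
     S (INR n + 1) >= 0 ->
     (forall delta, 0 < delta < INR n + 1 -> 0 < S delta) ->
     (forall delta, 0 < delta < INR n + 1 ->
        S delta < - delta * S' delta * (S delta - (INR n + 1 - delta))) ->
     forall delta, 0 < delta < INR n + 1 -> S delta > sn n delta).
Proof.
  split.
  - exact (subsolution_lt_sn n).
  - intros S S' C _; exact (supersolution_gt_sn n S S' C).
Qed.
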